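(* In the setting and notation described in the context (GKSM iteration), assume $K<+\infty$ and $0<\alpha_{\min}\le\alpha_k\le\alpha_{\max}<\frac{2\underline{\eta}}{\underline{\eta}+L}$ for all $k$; put $\upsilon:=\frac{\underline{\eta}}{\alpha_{\max}}-\frac{\underline{\eta}+L}{2}>0$. Then: (i) $\|\mathbf x_{k+1}-\mathbf x_k\|\to0$, and every cluster point $\hat{\mathbf x}$ of $\{\mathbf x_k\}$ is a critical point of $\min_{\mathbf x\in\mathcal C}F(\mathbf x)$, i.e. $\mathbf 0\in\nabla F(\hat{\mathbf x})+\partial\iota_{\mathcal C}(\hat{\mathbf x})$. (ii) Suppose moreover that $\mathbf x_k\to\mathbf x^*$ and that $F_{\mathcal C}$ satisfies the KL inequality at $\bar{\mathbf x}=\mathbf x^*$ with desingularizing function $\varphi(s)=c\,s^{1-t}$ ($c>0$, $t\in[0,1)$), constant $\eta>0$ and a neighborhood $\mathcal U$ of $\mathbf x^*$ containing a closed ball $\mathcal B(\mathbf x^*,\Lambda)$, $\Lambda>0$. Set $F^*:=F(\mathbf x^* )$. Then there exists $K'>K+1$ such that $\mathbf x_k\in\mathcal B(\mathbf x^*,\Lambda)$ and $|F_{\mathcal C}(\mathbf x_k)-F^*|<\eta$ for all $k\ge K'$, and, with $F_{K'}:=F(\mathbf x_{K'})-F^*$ and $\gamma:=\sup_k\frac{[c(L\alpha_k+\overline{\eta})]^2}{\upsilon(1-t)^2\alpha_k^2}$, the following hold for $k\ge K'$: 1. if $t=0$: $F(\mathbf x_{k+1})-F^*\le\big(F_{K'}-\tfrac{1}{\gamma}(k-K'+1)\big)_+$,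 where $(a)_+=\max(a,0)$; 2. if $t\in(0,\tfrac12]$: $F(\mathbf x_{k+1})-F^*\le\Big(1-\frac{F_{K'}^{2t-1}}{F_{K'}^{2t-1}+\gamma}\Big)^{k-K'+1}F_{K'}$; 3. if $t\in(\tfrac12,1)$: for every $\sigma\in(0,1)$ and all sufficiently large $k$, $F(\mathbf x_{k+1})-F^*\le\big(F_{K'}^{1-2t}+q\,(k-K'+1)\big)^{\frac{1}{1-2t}}$ with $q=(t-\tfrac12)(1-\sigma)^{2t}/\gamma$.
   Context: Setting. Identify $\mathbb C^N$ with $\mathbb R^{2N}$ equipped with the real inner product $\mathrm{Re}\langle\mathbf u,\mathbf v\rangle$, where $\langle\mathbf u,\mathbf v\rangle=\mathbf u^{H}\mathbf v$ ($^H$ = conjugate transpose); all gradients are taken with respect to this inner product. Let $\mathbf A\in\mathbb C^{m\times N}$, $\mathbf y\in\mathbb C^m$ with $\mathbf A^H\mathbf y\neq\mathbf 0$, and $h(\mathbf x)=\frac12\|\mathbf A\mathbf x-\mathbf y\|_2^2$ (so $\nabla h(\mathbf x)=\mathbf A^H(\mathbf A\mathbf x-\mathbf y)$). Let $f:\mathbb C^N\to\mathbb R$ be differentiable and bounded below, with $\nabla f$ $L$-Lipschitz ($L>0$): $\|\nabla f(\mathbf x_1)-\nabla f(\mathbf x_2)\|\le L\|\mathbf x_1-\mathbf x_2\|$. Let $\mathcal C\subseteq\mathbb C^N$ be nonempty, closed and convex, $\iota_{\mathcal C}$ its indicator function ($0$ on $\mathcal C$, $+\infty$ outside), $F=h+f$,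 $F_{\mathcal C}=F+\iota_{\mathcal C}$, and $\|\mathbf x\|_{\mathbf M}^2=\mathbf x^H\mathbf M\mathbf x$. GKSM iteration. Fix $K\in\{1,2,\dots\}\cup\{+\infty\}$, stepsizes $\alpha_k>0$, and Hermitian matrices $\mathbf B_k\in\mathbb C^{N\times N}$ with $\underline{\eta}\,\mathbf I\preceq\mathbf B_k\preceq\overline{\eta}\,\mathbf I$ for all $k$, where $0<\underline{\eta}\le\overline{\eta}<\infty$ (in the paper $\mathbf B_k$ is produced by a modified self-scaling Hermitian rank-one quasi-Newton rule whose output satisfies these bounds). Let $\mathbf V_1=\mathbf A^H\mathbf y/\|\mathbf A^H\mathbf y\|$ and choose $\mathbf x_1\in\mathcal C\cap\operatorname{range}(\mathbf V_1)$. For $k=1,2,\dots$: define $\bar F_k(\mathbf x)=h(\mathbf x)+\mathrm{Re}\langle\nabla f(\mathbf x_k),\mathbf x\rangle+\frac{1}{2\alpha_k}\|\mathbf x-\mathbf x_k\|_{\mathbf B_k}^2$; let $\boldsymbol\beta_k$ be the (unique) minimizer of $\boldsymbol\beta\mapsto\bar F_k(\mathbf V_k\boldsymbol\beta)$ over $\{\boldsymbol\beta:\mathbf V_k\boldsymbol\beta\in\mathcal C\}$, and set $\mathbf x_{k+1}=\mathbf V_k\boldsymbol\beta_k$. Then, if $k\le K$: compute $\mathbf r_k=\nabla\bar F_k(\mathbf x_{k+1})=\mathbf A^H(\mathbf A\mathbf x_{k+1}-\mathbf y)+\nabla f(\mathbf x_k)+\alpha_k^{-1}\mathbf B_k(\mathbf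 x_{k+1}-\mathbf x_k)$ and $\tilde{\mathbf r}_k=(\mathbf I-\mathbf V_k\mathbf V_k^H)\mathbf r_k$; if $\tilde{\mathbf r}_k\ne\mathbf 0$ set $\mathbf V_{k+1}=[\mathbf V_k,\ \tilde{\mathbf r}_k/\|\tilde{\mathbf r}_k\|]$, otherwise $\mathbf V_{k+1}=\mathbf V_k$. If $k>K$: set $\mathbf V_{k+1}=\mathbf I_N$. (Thus every $\mathbf V_k$ has orthonormal columns, $\mathbf V_k^H\mathbf V_k=\mathbf I$.) KL inequality. A proper lower semicontinuous $\chi:\mathbb C^N\to(-\infty,+\infty]$ satisfies the Kurdyka–Łojasiewicz inequality at $\bar{\mathbf x}\in\operatorname{dom}\partial\chi$ if there exist $\eta>0$, a neighborhood $\mathcal U$ of $\bar{\mathbf x}$ and a continuous concave $\varphi:[0,\eta)\to\mathbb R_+$, continuously differentiable on $(0,\eta)$, with $\varphi(0)=0$ and $\varphi'>0$ on $(0,\eta)$, such that $\varphi'(|\chi(\mathbf x)-\chi(\bar{\mathbf x})|)\cdot\operatorname{dist}(\mathbf 0,\partial\chi(\mathbf x))\ge1$ for all $\mathbf x\in\mathcal U$ with $|\chi(\mathbf x)-\chi(\bar{\mathbf x})|<\eta$. Here $\partial$ denotes the (limiting) subdifferential and $\operatorname{dist}$ the Euclidean distance. *)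

(* Defs.v *)
(* mathcomp-analysis reals + real_closed complex numbers R[i]. *)
From HB Require Import structures.
From mathcomp Require Import all_boot all_order all_algebra.
From mathcomp Require Import all_classical all_reals all_analysis.
From mathcomp Require Import complex.
Set Implicit Arguments. Unset Strict Implicit. Unset Printing Implicit Defensive.
Import Order.TTheory GRing.Theory Num.Theory numFieldNormedType.Exports.
Local Open Scope ring_scope.
Local Open Scope classical_set_scope.

Section Defs.
Variables (R : realType) (N : nat).
Local Notation C := (R[i]).
Local Notation vec := ('cV[C]_N).

(* conjugate transpose *)
Definition adj (m n : nat) (M : 'M[C]_(m, n)) : 'M[C]_(n, m) :=
  (map_mx (fun z : C => z^*) M)^T.

(* <u,v> = u^H v, real inner product Re<u,v>, Euclidean norm *)
Definition cdot (u v : vec) : C := (adj u *m v) 0 0.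
Definition rip (u v : vec) : R := complex.Re (cdot u v).
Definition normv (v : vec) : R := Num.sqrt (rip v v).

(* Hermitian matrix and Loewner bounds  etaL I <= M <= etaH I *)
Definition hermitianM (M : 'M[C]_N) := adj M = M.
Definition loewner_bounds (etaL etaH : R) (M : 'M[C]_N) :=
  forall v : vec, etaL * normv v ^+ 2 <= complex.Re (cdot v (M *m v))
               /\ complex.Re (cdot v (M *m v)) <= etaH * normv v ^+ 2.

(* (Frechet) gradient w.r.t. the real inner product Re<.,.> *)
Definition is_gradient (f : vec -> R) (g : vec -> vec) :=
  forall x (e : R), 0 < e -> exists2 d : R, 0 < d &
    forall h : vec, normv h < d ->
      `| f (x + h) - f x - rip (g x) h | <= e * normv h.

Definition lipschitzv (g : vec -> vec) (L : R) :=
  forall x1 x2, normv (g x1 - g x2) <= L * normv (x1 - x2).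

Definition closedv (S : set vec) :=
  forall x, (forall e : R, 0 < e -> exists z, S z /\ normv (z - x) < e) -> S x.

Definition convexv (S : set vec) :=
  forall u v (l : R), S u -> S v -> 0 <= l <= 1 ->
    S ((l%:C)%C *: u + ((1 - l)%:C)%C *: v).

(* indicator function of S *)
Definition indicator (S : set vec) (x : vec) : \bar R :=
  if `[< S x >] then 0%E else +oo%E.

(* convergence of vector sequences *)
Definition cvgv (u : nat -> vec) (l : vec) :=
  (fun n => normv (u n - l)) @ \oo --> (0 : R).

(* Frechet (regular) subdifferential *)
Definition frechet_subdiff (chi : vec -> \bar R) (x : vec) : set vec :=
  [set v | chi x \is a fin_num /\
    forall e : R, 0 < e -> exists2 d : R, 0 < d &
      forall z : vec, normv (z - x) < d ->
        (chi x + (rip v (z - x) - e * normv (z - x))%:E <= chi z)%E].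

(* limiting subdifferential *)
Definition subdiff (chi : vec -> \bar R) (x : vec) : set vec :=
  [set v | exists (xs vs : nat -> vec),
     [/\ cvgv xs x,
         chi x \is a fin_num,
         (fun n => fine (chi (xs n))) @ \oo --> fine (chi x),
         (forall n, frechet_subdiff chi (xs n) (vs n)) & cvgv vs v]].

(* dist(0, S) in the extended reals (+oo if S is empty) *)
Definition dist0 (S : set vec) : \bar R :=
  ereal_inf [set (normv v)%:E | v in S].

(* KL inequality at xbar with constant eta, neighborhood U, desingularizing phi *)
Definition KL_at (chi : vec -> \bar R) (xbar : vec) (eta : R) (U : set vec)
    (phi : R -> R) :=
  [/\ exists v, subdiff chi xbar v,
      exists2 r : R, 0 < r & (forall z, normv (z - xbar) < r -> U z)
    & forall x, U x ->
        (0 < `| chi x - chi xbar | < eta%:E)%E ->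
        ((derive1 phi (fine `| chi x - chi xbar |))%:E * dist0 (subdiff chi x)
           >= 1)%E].

(* matrix whose columns are the vectors of s *)
Definition colmat (s : seq vec) : 'M[C]_(N, size s) :=
  \matrix_(i < N, j < size s) (nth 0 s j) i 0.

Definition idcols : seq vec := [seq col j (1%:M : 'M[C]_N) | j <- enum 'I_N].

End Defs.

Section GKSM.
Variables (R : realType) (N m : nat).
Local Notation C := (R[i]).
Local Notation vec := ('cV[C]_N).
Variables (A : 'M[C]_(m, N)) (y : 'cV[C]_m).

(* h(x) = 1/2 ||Ax - y||^2 and its gradient A^H (Ax - y) *)
Definition hfun (x : vec) : R := 2^-1 * normv (A *m x - y) ^+ 2.
Definition gradh (x : vec) : vec := adj A *m (A *m x - y).

(* the GKSM iteration (indices k = 1, 2, ...), with data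
   f, gradf, S (= the set C), K, alpha, B, iterates x and bases V
   (V k is the list of the columns of V_k) *)
Definition GKSM (gradf : vec -> vec) (S : set vec) (K : nat)
    (alpha : nat -> R) (B : nat -> 'M[C]_N) (x : nat -> vec)
    (V : nat -> seq vec) :=
  let Fbar k (z : vec) : R :=
    hfun z + rip (gradf (x k)) z
    + (2 * alpha k)^-1 * complex.Re (cdot (z - x k) (B k *m (z - x k))) in
  [/\ V 1%N = [:: ((normv (adj A *m y))^-1)%:C%C *: (adj A *m y)],
      S (x 1%N) /\ exists b : 'cV[C]_(size (V 1%N)), x 1%N = colmat (V 1%N) *m b,
      (forall k, (1 <= k)%N ->
         exists b : 'cV[C]_(size (V k)),
           [/\ x k.+1 = colmat (V k) *m b, S (colmat (V k) *m b) &
               forall b' : 'cV[C]_(size (V k)), S (colmat (V k) *m b') ->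
                 Fbar k (colmat (V k) *m b) <= Fbar k (colmat (V k) *m b')]),
      (forall k, (1 <= k <= K)%N ->
         let r := gradh (x k.+1) + gradf (x k)
                  + ((alpha k)^-1)%:C%C *: (B k *m (x k.+1 - x k)) in
         let rt := r - colmat (V k) *m (adj (colmat (V k)) *m r) in
         V k.+1 = if rt != 0 then rcons (V k) (((normv rt)^-1)%:C%C *: rt)
                  else V k) &
      (forall k, (K < k)%N -> V k.+1 = idcols R N)].

End GKSM.

(* Main.v *)
(** Each step minimises the model [h + <gradf x_k, .> + |. - x_k|_B^2 / (2 alpha)], which is
    exactly quadratic, so first-order optimality at [x_(k+1)] together with the descent lemma
    for [f] gives [F x_k - F x_(k+1) >= ups |x_(k+1) - x_k|^2].  As [F] is bounded below, the
    steps tend to [0].  Once the subspace is the whole space, the optimality condition holds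
    against every point of [S]; passing to the limit gives criticality of cluster points, and
    moving the linearisation errors to one side exhibits an element of the subdifferential of
    [F + indicator S] at [x_(k+1)] of norm at most [(L + etaH / alpha) |x_(k+1) - x_k|].  Fed
    into the KL inequality this yields, for [s_k = F x_k - F xs], the recursion
    [s_(k+1)^(2t) <= gam (s_k - s_(k+1))], from which the three rates follow. *)
Require Import Defs.
From HB Require Import structures.
From mathcomp Require Import all_boot all_order all_algebra.
From mathcomp Require Import all_classical all_reals all_analysis.
From mathcomp Require Import complex ring lra.
Import Order.TTheory GRing.Theory Num.Theory numFieldNormedType.Exports.
Local Open Scope ring_scope.
Local Open Scope classical_set_scope.
Set Implicit Arguments. Unset Strict Implicit. Unset Printing Implicit Defensive.

(** * The real inner product on complex vectors and its norm *)

Section InnerProduct.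
Variables (R : realType) (n : nat).
Local Notation C := (R[i]).
Implicit Types (u v w : 'cV[C]_n) (a : R).

Lemma ripE u v : rip u v =
  \sum_i (complex.Re (u i 0) * complex.Re (v i 0)
          + complex.Im (u i 0) * complex.Im (v i 0)).
Proof.
rewrite /rip /cdot /adj mxE raddf_sum; apply: eq_bigr => i _; rewrite !mxE.
by case: (u i 0) => a b; case: (v i 0) => c d /=; ring.
Qed.

Lemma ripC u v : rip u v = rip v u.
Proof. by rewrite !ripE; apply: eq_bigr => i _; ring. Qed.

Lemma ripDr u v w : rip u (v + w) = rip u v + rip u w.
Proof. by rewrite /rip /cdot mulmxDr mxE raddfD. Qed.

Lemma ripDl u v w : rip (v + w) u = rip v u + rip w u.
Proof. by rewrite ripC ripDr !(ripC u). Qed.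

Lemma ripZr a u v : rip u (a%:C%C *: v) = a * rip u v.
Proof.
rewrite !ripE mulr_sumr; apply: eq_bigr => i _; rewrite mxE.
by case: (v i 0) => c d /=; ring.
Qed.

Lemma ripZl a u v : rip (a%:C%C *: u) v = a * rip u v.
Proof. by rewrite ripC ripZr ripC. Qed.

Lemma ripNr u v : rip u (- v) = - rip u v.
Proof. by rewrite /rip /cdot mulmxN mxE raddfN. Qed.

Lemma ripNl u v : rip (- u) v = - rip u v.
Proof. by rewrite ripC ripNr ripC. Qed.

Lemma rip0r u : rip u 0 = 0.
Proof. by rewrite /rip /cdot mulmx0 mxE. Qed.

Lemma rip_ge0 u : 0 <= rip u u.
Proof. by rewrite ripE; apply: sumr_ge0 => i _; rewrite addr_ge0 // -expr2 sqr_ge0. Qed.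

Lemma rip_eq0 u : rip u u = 0 -> u = 0.
Proof.
rewrite ripE => /eqP; rewrite psumr_eq0; last first.
  by move=> i _; rewrite addr_ge0 // -expr2 sqr_ge0.
move=> /allP u0; apply/matrixP => i j; rewrite (ord1 j) mxE.
have := u0 i (mem_index_enum _); rewrite /= -!expr2 paddr_eq0 ?sqr_ge0 //.
by rewrite !sqrf_eq0; case: (u i 0) => a b /= /andP[/eqP -> /eqP ->].
Qed.

Definition ripE_lin := (ripDl, ripDr, ripNl, ripNr, ripZl, ripZr).

Lemma normv_ge0 u : 0 <= normv u.
Proof. exact: sqrtr_ge0. Qed.

Lemma normv_sqr u : normv u ^+ 2 = rip u u.
Proof. by rewrite sqr_sqrtr ?rip_ge0. Qed.

Lemma normv0 : normv (0 : 'cV[C]_n) = 0.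
Proof. by rewrite /normv rip0r sqrtr0. Qed.

Lemma normvN u : normv (- u) = normv u.
Proof. by rewrite /normv ripNl ripNr opprK. Qed.

Lemma normvZ a u : normv (a%:C%C *: u) = `|a| * normv u.
Proof.
by rewrite /normv ripZl ripZr mulrA -expr2 sqrtrM ?sqr_ge0 // sqrtr_sqr.
Qed.

(** Cauchy-Schwarz, from the nonnegative square of |v| u - |u| v. Vanishing norms are treated apart
    because the factor |u| |v| is cancelled at the end. *)
Lemma rip_le u v : rip u v <= normv u * normv v.
Proof.
have uge := normv_ge0 u; have vge := normv_ge0 v.
have [u0|u_gt0] := leP (normv u) 0.
  have u00 : u = 0 by apply: rip_eq0; rewrite -normv_sqr; nra.
  by rewrite u00 ripC rip0r normv0 mul0r.
have [v0|v_gt0] := leP (normv v) 0.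
  have v00 : v = 0 by apply: rip_eq0; rewrite -normv_sqr; nra.
  by rewrite v00 rip0r normv0 mulr0.
have := rip_ge0 ((normv v)%:C%C *: u - (normv u)%:C%C *: v).
rewrite !ripE_lin (ripC v u) -!normv_sqr => h.
have uv : 0 < normv u * normv v by exact: mulr_gt0.
by rewrite -(ler_pM2l uv); nra.
Qed.

Lemma normr_rip_le u v : `|rip u v| <= normv u * normv v.
Proof. by rewrite ler_norml rip_le lerNl -ripNl -(normvN u) rip_le. Qed.

Lemma ler_normvD u v : normv (u + v) <= normv u + normv v.
Proof.
rewrite -(@ler_sqr _ (normv (u + v))) ?nnegrE ?addr_ge0 ?normv_ge0 //.
rewrite normv_sqr !ripE_lin (ripC v u) -!normv_sqr.
have := rip_le u v; nra.
Qed.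

Lemma normvB u v : normv (u - v) = normv (v - u).
Proof. by rewrite -normvN opprB. Qed.

(** Moves a variational inequality from [(g, w)] to [(h, v)]: [u - v] is split at [w], then [h] is
    traded for [g]. It serves to pass from iterates to a cluster point. *)
Lemma rip_perturb_ge g h u v w a b c : 0 <= rip g (u - w) ->
  normv (g - h) <= a -> normv (w - v) <= b -> normv (u - w) <= c ->
  - (normv h * b + a * c) <= rip h (u - v).
Proof.
move=> gu gh wv uw.
have -> : rip h (u - v) = rip g (u - w) + rip h (w - v) - rip (g - h) (u - w).
  by rewrite !ripE_lin; ring.
rewrite opprD lerD //; last first.
  by rewrite lerN2 (le_trans (rip_le _ _)) // ler_pM ?normv_ge0.
rewrite -[leLHS]add0r lerD // lerNl -ripNl (le_trans (rip_le _ _)) //.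
by rewrite normvN ler_wpM2l ?normv_ge0.
Qed.

End InnerProduct.

(** * Adjoints and operator bounds for complex matrices *)

Section Adjoint.
Variable R : realType.
Local Notation C := (R[i]).

Lemma adjM (p q r : nat) (M : 'M[C]_(p, q)) (P : 'M[C]_(q, r)) :
  adj (M *m P) = adj P *m adj M.
Proof. by rewrite /adj map_mxM trmx_mul. Qed.

Lemma adjK (p q : nat) (M : 'M[C]_(p, q)) : adj (adj M) = M.
Proof. by apply/matrixP => i j; rewrite !mxE conjCK. Qed.

Lemma rip_mulmxl (p q : nat) (M : 'M[C]_(p, q)) u v :
  rip (M *m u) v = rip u (adj M *m v).
Proof. by rewrite /rip /cdot adjM mulmxA. Qed.

Lemma rip_mulmxr (p q : nat) (M : 'M[C]_(p, q)) u v :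
  rip u (M *m v) = rip (adj M *m u) v.
Proof. by rewrite rip_mulmxl adjK. Qed.

(** Real and imaginary parts of each entry of [M *m u] are real inner products of [u] with fixed
    vectors, so Cauchy-Schwarz applies row by row. The vector [rowiv i] is [rowv i] multiplied by
    the imaginary unit, which turns the imaginary part into a real inner product. *)
Lemma normv_mulmx_bounded (p q : nat) (M : 'M[C]_(p, q)) :
  exists2 b : R, 0 <= b & forall u, normv (M *m u) <= b * normv u.
Proof.
pose rowv (i : 'I_p) : 'cV[C]_q := adj (row i M).
pose rowiv (i : 'I_p) : 'cV[C]_q := ('i)%C *: rowv i.
pose g (i : 'I_p) := normv (rowv i) ^+ 2 + normv (rowiv i) ^+ 2.
have g_ge0 i : 0 <= g i by rewrite addr_ge0 ?sqr_ge0.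
exists (Num.sqrt (\sum_i g i)) => [|u]; first exact: sqrtr_ge0.
rewrite -(@ler_sqr _ (normv (M *m u))) ?nnegrE ?mulr_ge0 ?sqrtr_ge0 ?normv_ge0 //.
rewrite exprMn normv_sqr ripE sqr_sqrtr ?sumr_ge0 // mulr_suml.
apply: ler_sum => i _.
have Mui : (M *m u) i 0 = cdot (rowv i) u.
  rewrite /cdot /rowv adjK mxE [RHS]mxE; apply: eq_bigr => j _; by rewrite mxE.
have ReE : complex.Re ((M *m u) i 0) = rip (rowv i) u by rewrite Mui.
have ImE : complex.Im ((M *m u) i 0) = rip (rowiv i) u.
  have cZ : cdot (rowiv i) u = (- 'i)%C * cdot (rowv i) u.
    rewrite /cdot !mxE mulr_sumr; apply: eq_bigr => j _; rewrite !mxE.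
    case: (M i j) => a b; case: (u j 0) => c d /=.
    by apply/eqP; rewrite eq_complex /=; apply/andP; split; apply/eqP; ring.
  rewrite Mui /rip cZ; case: (cdot _ _) => a b /=; ring.
rewrite ReE ImE -!expr2 /g mulrDl; apply: lerD; rewrite -exprMn -ler_sqrt ?sqr_ge0 //;
  by rewrite !sqrtr_sqr (le_trans (normr_rip_le _ _)) ?ler_norm.
Qed.

(* The form [rip z (M *m z)] is nonnegative at [z = M *m v - etaH v]. *)
Lemma loewner_normv_le (p : nat) (etaL etaH : R) (M : 'M[C]_p) v :
  0 < etaL -> etaL <= etaH -> hermitianM M -> loewner_bounds etaL etaH M ->
  normv (M *m v) <= etaH * normv v.
Proof.
move=> etaL0 etaLH herm bnd.
have etaH0 : 0 < etaH by exact: lt_le_trans etaLH.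
have [Mv0|Mv_gt0] := leP (normv (M *m v)) 0.
  by rewrite (le_trans Mv0) ?mulr_ge0 ?normv_ge0 // ltW.
set w := M *m v.
have psd z : 0 <= rip z (M *m z).
  by apply: le_trans (proj1 (bnd z)); rewrite mulr_ge0 ?sqr_ge0 ?ltW.
have := psd (w - etaH%:C%C *: v).
rewrite mulmxBr -scalemxAr !ripE_lin -/w.
have -> : rip v (M *m w) = rip w w by rewrite rip_mulmxr herm.
have := proj2 (bnd w); rewrite -/(rip w (M *m w)).
have := proj2 (bnd v); rewrite -/(rip v (M *m v)) -/w.
rewrite -!normv_sqr => hv hw h.
rewrite -ler_sqr ?nnegrE ?mulr_ge0 ?normv_ge0 ?(ltW etaH0) //.
rewrite -(ler_pM2l etaH0) exprMn; nra.
Qed.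

End Adjoint.

(** * Gradients, the descent lemma and continuity *)

Section Gradient.
Variables (R : realType) (n : nat).
Local Notation vec := 'cV[R[i]]_n.
Implicit Types (f : vec -> R) (g : vec -> vec) (x d z : vec).

Lemma is_derive_line f g x d (s : R) : is_gradient f g ->
  is_derive s 1 (fun r => f (x + r%:C%C *: d)) (rip (g (x + s%:C%C *: d)) d).
Proof.
move=> fg; set F := fun r : R => _; set l := rip _ d.
have cv : (fun h => h^-1 *: ((F \o shift s) (h *: 1) - F s)) @ 0^' --> l.
  apply/cvgrPdist_le => e e0.
  (* The tolerance is divided by [normv d + 1] rather than [normv d] to cover [d = 0]. *)
  have nd1 : 0 < normv d + 1 by rewrite ltr_wpDl ?normv_ge0.
  have [r r0 Hr] := fg (x + s%:C%C *: d) _ (divr_gt0 e0 nd1).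
  near=> h.
  have h0 : h != 0 by near: h; exact: nbhs_dnbhs_neq.
  have hr : `|h| < r / (normv d + 1).
    by near: h; apply: dnbhs0_lt; rewrite divr_gt0.
  have h_gt0 : 0 < `|h| by rewrite normr_gt0.
  have hd : normv (h%:C%C *: d) < r.
    rewrite normvZ; apply: le_lt_trans (_ : `|h| * (normv d + 1) < r).
      by rewrite ler_wpM2l // lerDl.
    by rewrite -ltr_pdivlMr.
  have := Hr _ hd; rewrite ripZr normvZ => Hh.
  have FE : (F \o shift s) (h *: 1) = f (x + s%:C%C *: d + h%:C%C *: d).
    by rewrite /F /= -addrA -scalerDl -rmorphD /= addrC /GRing.scale /= mulr1 addrC (addrC h).
  rewrite FE -/(F s) distrC.
  have -> : h^-1 *: (f (x + s%:C%C *: d + h%:C%C *: d) - F s) - l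
     = h^-1 * (f (x + s%:C%C *: d + h%:C%C *: d) - f (x + s%:C%C *: d) - h * l).
    by rewrite /GRing.scale /= [in RHS]mulrBr mulrA mulVf // mul1r.
  rewrite normrM normfV mulrC ler_pdivrMr //; apply: le_trans Hh _.
  rewrite -(mulrA e) ler_wpM2l ?(ltW e0) // mulrCA -[leRHS]mulr1 ler_wpM2l //.
  by rewrite mulrC ler_pdivrMr // mul1r lerDl.
by apply: DeriveDef; [apply/cvg_ex; exists l | rewrite /derive; apply: cvg_lim].
Unshelve. all: by end_near. Qed.

(** Descent lemma. Subtracting the whole quadratic before using the mean value theorem gives the
    sharp factor [L / 2]: by Cauchy-Schwarz and the Lipschitz bound, the difference has nonpositive
    derivative on [0, 1]. *)
Lemma lipschitz_gradient_le f g (L : R) x d :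
  is_gradient f g -> lipschitzv g L ->
  f (x + d) <= f x + rip (g x) d + L / 2 * normv d ^+ 2.
Proof.
move=> fg gL.
pose F (s : R) := f (x + s%:C%C *: d).
pose p (s : R) := - (rip (g x) d * s + L / 2 * normv d ^+ 2 * s ^+ 2).
pose dF (s : R) := rip (g (x + s%:C%C *: d)) d
   + - (rip (g x) d + L * normv d ^+ 2 * s).
have dF_ (s : R) : is_derive s 1 (F + p : R -> R) (dF s).
  apply: is_deriveD; first exact: is_derive_line.
  apply: is_deriveN.
  by apply: is_derive_eq; rewrite /GRing.scale /=; field.
have [|c /itvP cI] := @MVT R _ _ 0 1 ltr01 (fun s _ => dF_ s).
  apply: continuous_subspaceT => s; apply: differentiable_continuous.
  by apply/derivable1_diffP; have [] := dF_ s.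
rewrite subr0 mulr1 => E.
have E1 : f (x + d) - rip (g x) d - L / 2 * normv d ^+ 2 - f x = dF c.
  rewrite -E !fctE /F /p rmorph0 rmorph1 scale0r addr0 scale1r; ring.
suff : dF c <= 0 by lra.
have c0 : 0 <= c by rewrite cI.
have := rip_le (g (x + c%:C%C *: d) - g x) d.
have := gL (x + c%:C%C *: d) x.
rewrite addrAC subrr add0r normvZ (ger0_norm c0) !ripE_lin /dF => h1 h2.
have := normv_ge0 d; nra.
Qed.

Lemma is_gradientD f1 g1 f2 g2 : is_gradient f1 g1 -> is_gradient f2 g2 ->
  is_gradient (fun z => f1 z + f2 z) (fun z => g1 z + g2 z).
Proof.
move=> fg1 fg2 x e e0.
have e2 : 0 < e / 2 by rewrite divr_gt0.
have [d1 d10 H1] := fg1 x _ e2; have [d2 d20 H2] := fg2 x _ e2.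
exists (Num.min d1 d2); first by rewrite lt_min d10.
move=> h; rewrite lt_min => /andP[/H1 h1 /H2 h2]; rewrite ripDl.
rewrite (_ : _ - _ = (f1 (x + h) - f1 x - rip (g1 x) h)
  + (f2 (x + h) - f2 x - rip (g2 x) h)); last by ring.
by apply: le_trans (ler_normD _ _) _; lra.
Qed.

(** Differentiability with tolerance [1] bounds the variation of [f] near [x] by [1 + normv (g x)]
    times the distance to [x]. *)
Lemma is_gradient_cvg f g (u : nat -> vec) x :
  is_gradient f g -> cvgv u x -> (fun k => f (u k)) @ \oo --> f x.
Proof.
move=> fg ux; apply/cvgrPdistC_lt => e e0.
have [d d0 Hd] := fg x 1 ltr01.
have b0 : 0 < 1 + normv (g x) by rewrite ltr_pwDl ?normv_ge0.
have r0 : 0 < Num.min d (e / (1 + normv (g x))) by rewrite lt_min d0 divr_gt0.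
have /cvgr0Pnorm_lt /(_ _ r0) := ux.
apply: filterS => k; rewrite ger0_norm ?normv_ge0 // lt_min => /andP[ud ue].
have := Hd _ ud; rewrite mul1r [x + _]addrC subrK => fd.
have gd := normr_rip_le (g x) (u k - x).
have -> : f (u k) - f x = (f (u k) - f x - rip (g x) (u k - x)) + rip (g x) (u k - x).
  by rewrite subrK.
apply: le_lt_trans (ler_normD _ _) _.
apply: le_lt_trans (lerD fd gd) _.
by rewrite -{1}[normv (u k - x)]mul1r -mulrDl mulrC -ltr_pdivlMr.
Qed.

End Gradient.

(** * The least-squares term and its gradient *)

Section LeastSquares.
Variables (R : realType) (n m : nat) (A : 'M[R[i]]_(m, n)) (y : 'cV[R[i]]_m).
Implicit Types x d : 'cV[R[i]]_n.

Lemma hfunD x d : hfun A y (x + d)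
  = hfun A y x + rip (gradh A y x) d + 2^-1 * normv (A *m d) ^+ 2.
Proof.
rewrite /hfun /gradh (mulmxDr A x) (addrAC (A *m x)) rip_mulmxl adjK.
by rewrite !normv_sqr !ripE_lin !(ripC (A *m d)); field.
Qed.

Lemma hfun_ge0 x : 0 <= hfun A y x.
Proof. by rewrite mulr_ge0 ?sqr_ge0 // invr_ge0. Qed.

Lemma is_gradient_hfun : is_gradient (hfun A y) (gradh A y).
Proof.
move=> x e e0; have [b b0 Hb] := normv_mulmx_bounded A.
have c0 : 0 < b ^+ 2 + 1 by rewrite ltr_wpDl ?sqr_ge0.
(* The remainder is at most b^2 |h|^2 / 2; adding [1] keeps the denominator positive when
   [b = 0]. *)
exists (e / (b ^+ 2 + 1)); first by rewrite divr_gt0.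
move=> h; rewrite ltr_pdivlMr // => hh; rewrite hfunD.
rewrite (_ : _ - _ = 2^-1 * normv (A *m h) ^+ 2); last by ring.
rewrite ger0_norm ?mulr_ge0 ?exprn_ge0 ?normv_ge0 ?invr_ge0 //.
have := normv_ge0 h; have := normv_ge0 (A *m h); have := Hb h => h1 h2 h3.
have : normv (A *m h) ^+ 2 <= (b * normv h) ^+ 2.
  by rewrite ler_sqr // nnegrE mulr_ge0.
rewrite exprMn => h4.
have : normv h * (normv h * (b ^+ 2 + 1)) <= normv h * e.
  by rewrite ler_wpM2l // ltW.
nra.
Qed.

Lemma gradh_lipschitz : exists2 b : R, 0 <= b & lipschitzv (gradh A y) b.
Proof.
have [b b0 Hb] := normv_mulmx_bounded A.
have [c c0 Hc] := normv_mulmx_bounded (adj A).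
exists (c * b) => [|x z]; first exact: mulr_ge0.
rewrite /gradh -mulmxBr opprB addrA subrK -mulmxBr.
by apply: le_trans (Hc _) _; rewrite -mulrA ler_wpM2l.
Qed.

End LeastSquares.

(** * Convergence rates of a scalar recursion *)

Section RecursionRates.
Variables (R : realType) (s : nat -> R) (k0 : nat) (gam t : R).
Hypothesis gam_gt0 : 0 < gam.
Hypothesis s_ge0 : forall k, (k0 <= k)%N -> 0 <= s k.
Hypothesis s_dec : forall k, (k0 <= k)%N -> s k.+1 <= s k.
(** Positivity of the new gap is assumed because the KL inequality concerns nonzero gaps only. As
    [0] to the power [0] is [1], for [t = 0] the recursion would fail at two consecutive zero
    gaps. *)
Hypothesis s_rec : forall k, (k0 <= k)%N -> 0 < s k.+1 ->
  s k.+1 `^ (2 * t) <= gam * (s k - s k.+1).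

Let s_anti k j : (k0 <= k)%N -> s (k + j)%N <= s k.
Proof.
move=> kk; elim: j => [|j IH]; first by rewrite addn0.
by rewrite addnS (le_trans _ IH) // s_dec // (leq_trans kk) ?leq_addr.
Qed.

(** For [t = 0] the left side of the recursion is [1], so every step that leaves the gap positive
    lowers it by at least [gam^-1]. *)
Lemma rate_finite : t = 0 -> forall k, (k0 <= k)%N ->
  s k.+1 <= Num.max (s k0 - gam^-1 * (k - k0).+1%:R) 0.
Proof.
move=> t0 k kk; rewrite -{1}(subnKC kk); elim: (k - k0)%N => [|j IH].
  have [s1|s1] := leP (s (k0 + 0).+1) 0; first by rewrite le_max s1 orbT.
  have := s_rec (leq_addr 0 k0) s1; rewrite t0 mulr0 powRr0 addn0 => h.
  rewrite le_max; apply/orP; left; rewrite mulr1.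
  have : gam^-1 * 1 <= gam^-1 * (gam * (s k0 - s k0.+1)).
    by rewrite ler_wpM2l // invr_ge0 ltW.
  by rewrite mulrA mulVf ?gt_eqF // mul1r mulr1; lra.
have [s1|s1] := leP (s (k0 + j.+1).+1) 0; first by rewrite le_max s1 orbT.
have := s_rec (leq_addr j.+1 k0) s1; rewrite t0 mulr0 powRr0 => h.
rewrite le_max; apply/orP; left.
have : gam^-1 * 1 <= gam^-1 * (gam * (s (k0 + j.+1)%N - s (k0 + j.+1).+1)).
  by rewrite ler_wpM2l // invr_ge0 ltW.
rewrite mulrA mulVf ?gt_eqF // mul1r mulr1 => h1.
have gi : 0 < gam^-1 by rewrite invr_gt0.
move: IH; rewrite -addnS le_max => /orP[IH|IH]; last lra.
by rewrite -[j.+2%:R]natr1 mulrDr mulr1; lra.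
Qed.

(** The exponent [2 * t - 1] is nonpositive and [s] decreases, so a positive s_(k+1) raised to it is
    at least [a]. The recursion then becomes the linear bound [(a + gam) * s k.+1 <= gam * s k]. *)
Lemma rate_linear : 0 < t <= 2^-1 -> forall k, (k0 <= k)%N ->
  s k.+1 <= (1 - s k0 `^ (2 * t - 1) / (s k0 `^ (2 * t - 1) + gam))
            ^+ (k - k0).+1 * s k0.
Proof.
move=> /andP[t0 t2] k kk; set a := s k0 `^ (2 * t - 1).
have a0 : 0 <= a by exact: powR_ge0.
have ag : 0 < a + gam by exact: ltr_wpDl.
have -> : 1 - a / (a + gam) = gam / (a + gam) by field; rewrite gt_eqF.
set r := gam / _; have r0 : 0 <= r by rewrite divr_ge0 ?ltW.
have step j : (k0 <= j)%N -> s j.+1 <= r * s j.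
  move=> kj; have [s1|s1] := leP (s j.+1) 0.
    by apply: le_trans s1 _; apply: mulr_ge0 => //; exact: s_ge0.
  have := s_rec kj s1; set b := s j.+1 in s1 *.
  have bk : b <= s k0.
    by rewrite /b -(subnKC (leq_trans kj (leqnSn j))) s_anti.
  have ab : a <= b `^ (2 * t - 1).
    have k0_gt0 : 0 < s k0 by exact: lt_le_trans bk.
    rewrite /a -[2 * t - 1]opprB !powRN lef_pV2 ?posrE ?powR_gt0 //.
    by apply: ge0_ler_powR; rewrite ?nnegrE ?(ltW s1) ?(ltW k0_gt0) //; lra.
  rewrite -(mulr_powRB1 (ltW s1)); last lra.
  have : b * a <= b * b `^ (2 * t - 1) by rewrite ler_wpM2l ?(ltW s1).
  move=> h1 h2; rewrite /r mulrAC ler_pdivlMr //; nra.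
rewrite -{1}(subnKC kk); elim: (k - k0)%N => [|j IH].
  by rewrite addn0 expr1 step.
rewrite exprS -mulrA; apply: le_trans (step _ _) _; first exact: leq_addr.
by rewrite ler_wpM2l // addnS.
Qed.

(** By the mean value theorem the right side is (2 t - 1) c^(- 2 t) (a - b) with b < c < a, and a
    negative power is smallest at the right end [a]. *)
Lemma powR_tangent_le (a b : R) : 2^-1 < t -> 0 < b -> b <= a ->
  (2 * t - 1) * a `^ (- (2 * t)) * (a - b) <= b `^ (1 - 2 * t) - a `^ (1 - 2 * t).
Proof.
move=> t2 b0; rewrite le_eqVlt => /orP[/eqP->|ba]; first by rewrite !subrr mulr0.
have [||c /itvP cI E] := @MVT R (@powR R ^~ (1 - 2 * t))
  (fun z => (1 - 2 * t) * z `^ (1 - 2 * t - 1)) b a ba.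
- by move=> z /itvP zI; apply: is_derive1_powR; rewrite (lt_trans b0) ?zI.
- apply: continuous_in_subspaceT => z; rewrite inE /= => /itvP zI.
  apply: differentiable_continuous; apply/derivable1_diffP.
  by apply: derivable_powR; rewrite in_itv /= (lt_le_trans b0) ?zI.
have c0 : 0 < c by rewrite (lt_trans b0) ?cI.
have -> : b `^ (1 - 2 * t) - a `^ (1 - 2 * t)
  = (2 * t - 1) * c `^ (- (2 * t)) * (a - b).
  rewrite -opprB E (_ : 1 - 2 * t - 1 = - (2 * t)); ring.
rewrite ler_wpM2r ?subr_ge0 ?(ltW ba) // ler_wpM2l //; first lra.
have a0 : 0 < a by exact: lt_trans ba.
rewrite !powRN lef_pV2 ?posrE ?powR_gt0 //.
have ca : c <= a by rewrite ltW ?cI.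
by apply: ge0_ler_powR; rewrite ?nnegrE ?(ltW c0) ?(ltW a0) //; lra.
Qed.

(* Along [u r = r `^ (1 - 2 t)], each step either loses little, and the tangent
   inequality gains [2 q], or shrinks [s] by the factor [1 - sigma], and then [u]
   gains a fixed fraction of itself, which exceeds [2 q] once [s] is small. *)
Lemma rate_sublinear : s @ \oo --> (0 : R) -> 2^-1 < t -> forall sigma : R,
  0 < sigma < 1 ->
  let q := (t - 2^-1) * (1 - sigma) `^ (2 * t) / gam in
  exists k1 : nat, forall k, (k1 <= k)%N -> (k0 <= k)%N ->
    s k.+1 <= (s k0 `^ (1 - 2 * t) + q * (k - k0).+1%:R) `^ (1 / (1 - 2 * t)).
Proof.
move=> s0 t2 sigma /andP[sg0 sg1] q.
have os : 0 < 1 - sigma by lra.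
have q0 : 0 < q by rewrite divr_gt0 // mulr_gt0 ?powR_gt0 //; lra.
have p0 : 0 < 2 * t - 1 by lra.
pose w := (1 - sigma) `^ (1 - 2 * t).
have w1 : 1 < w.
  rewrite /w -[1 - 2 * t]opprB powRN invf_gt1 ?powR_gt0 //.
  have := @gt0_ltr_powR R _ p0 (1 - sigma) 1; rewrite powR1; apply;
    rewrite ?nnegrE //; lra.
(* When s^(1 - 2 t) is at least [M], the fraction [w - 1] of it is at least [2 * q]. *)
pose M := 2 * q / (w - 1).
have M0 : 0 < M by rewrite divr_gt0 //; lra.
have /cvgr0Pnorm_lt /(_ (M `^ (1 / (1 - 2 * t)))) := s0.
rewrite powR_gt0 // => /(_ isT) [k1 _ Hk1].
pose k2 := (k0 + k1)%N.
have k02 : (k0 <= k2)%N by exact: leq_addr.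
have pK (z : R) : 0 <= z -> (z `^ (1 - 2 * t)) `^ (1 / (1 - 2 * t)) = z.
  move=> z0; rewrite -powRrM mulrC divfK ?powRr1 //.
  by rewrite lt_eqF //; lra.
have step k : (k2 <= k)%N -> 0 < s k.+1 ->
  s k `^ (1 - 2 * t) + 2 * q <= s k.+1 `^ (1 - 2 * t).
  move=> kk s1; have kk0 : (k0 <= k)%N by exact: leq_trans kk.
  have sk : 0 < s k by exact: lt_le_trans s1 (s_dec kk0).
  have [big|small] := leP ((1 - sigma) * s k) (s k.+1).
    have := powR_tangent_le t2 s1 (s_dec kk0).
    have h1 : ((1 - sigma) * s k) `^ (2 * t) <= s k.+1 `^ (2 * t).
      by apply: ge0_ler_powR; rewrite ?nnegrE ?mulr_ge0 ?(ltW sk) ?(ltW s1) ?(ltW os) //; lra.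
    have h2 := le_trans h1 (s_rec kk0 s1).
    move: h2; rewrite powRM ?(ltW os) ?(ltW sk) // => h2.
    have a0 : 0 < s k `^ (2 * t) by exact: powR_gt0.
    have h3 : (1 - sigma) `^ (2 * t) / gam <= s k `^ (- (2 * t)) * (s k - s k.+1).
      rewrite powRN ler_pdivrMr // -mulrA [leRHS]mulrC ler_pdivlMr //.
      by rewrite (mulrC (_ - _)).
    have : (2 * t - 1) * ((1 - sigma) `^ (2 * t) / gam)
         <= (2 * t - 1) * (s k `^ (- (2 * t)) * (s k - s k.+1)).
      by rewrite ler_wpM2l // ltW.
    have -> : (2 * t - 1) * ((1 - sigma) `^ (2 * t) / gam) = 2 * q.
      by rewrite /q; field; rewrite gt_eqF.
    by rewrite mulrA; lra.
  have h1 : ((1 - sigma) * s k) `^ (1 - 2 * t) <= s k.+1 `^ (1 - 2 * t).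
    rewrite -[1 - 2 * t]opprB !powRN lef_pV2 ?posrE ?powR_gt0 ?mulr_gt0 //.
    by apply: ge0_ler_powR; rewrite ?nnegrE ?mulr_ge0 ?(ltW sk) ?(ltW s1) ?(ltW os) ?(ltW small) ?(ltW p0).
  have h2 : M <= s k `^ (1 - 2 * t).
    rewrite leNgt; apply/negP => h.
    have := Hk1 k (leq_trans (leq_addl k0 k1) kk).
    rewrite /= ger0_norm ?(ltW sk) // => h3.
    have := @gt0_ltr_powR R _ p0 (s k) (M `^ (1 / (1 - 2 * t))).
    rewrite !nnegrE powR_ge0 (ltW sk) => /(_ isT isT h3).
    rewrite -powRrM (_ : 1 / (1 - 2 * t) * (2 * t - 1) = -1); last first.
      by field; rewrite lt_eqF //; lra.
    rewrite powR_inv1 ?(ltW M0) // -[2 * t - 1]opprB powRN ltf_pV2 ?posrE ?powR_gt0 //.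
    by rewrite ltNge (ltW h).
  have h3 : 2 * q <= (w - 1) * s k `^ (1 - 2 * t).
    move: h2; rewrite /M ler_pdivrMr; last lra.
    by rewrite (mulrC (s k `^ _)).
  move: h1; rewrite powRM ?(ltW os) ?(ltW sk) // -/w; lra.
have iter j : 0 < s (k2 + j).+1 ->
  s k2 `^ (1 - 2 * t) + 2 * q * j.+1%:R <= s (k2 + j).+1 `^ (1 - 2 * t).
  elim: j => [|j IH] sj; first by rewrite mulr1 addn0 step // -[X in s X.+1]addn0.
  have kj : (k2 <= k2 + j.+1)%N by exact: leq_addr.
  have sj' : 0 < s (k2 + j).+1.
    by rewrite -addnS (lt_le_trans sj) // s_dec // (leq_trans k02).
  have := step _ kj sj; have := IH sj'; rewrite -addnS => h1 h2.
  by rewrite -[j.+2%:R]natr1 mulrDr mulr1; lra.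
(* For [k >= 2 * k2] one has [k - k0 + 1 <= 2 * (k - k2 + 1)], so gaining [2 * q] per step from [k2]
   on pays for [q] per step counted from [k0]. *)
exists (k2 + k2)%N => k kk kk0.
have [s1|s1] := leP (s k.+1) 0; first exact: le_trans s1 (powR_ge0 _ _).
have k2k : (k2 <= k)%N by exact: leq_trans (leq_addr _ _) kk.
have := iter (k - k2)%N; rewrite subnKC // => /(_ s1) h1.
have sk2 : 0 < s k2.
  by rewrite (lt_le_trans s1) // -(subnKC (leq_trans k2k (leqnSn k))) s_anti.
have sk0 : 0 < s k0 by rewrite (lt_le_trans sk2) // s_anti.
have h2 : s k0 `^ (1 - 2 * t) <= s k2 `^ (1 - 2 * t).
  rewrite -[1 - 2 * t]opprB !powRN lef_pV2 ?posrE ?powR_gt0 //.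
  by apply: ge0_ler_powR; rewrite ?nnegrE ?(ltW sk2) ?(ltW sk0) ?(ltW p0) // s_anti.
have h3 : ((k - k0).+1%:R : R) <= 2 * (k - k2).+1%:R.
  rewrite -natrM ler_nat mul2n -addnn addSn addnS ltnS.
  apply: leq_trans (leq_subr _ _) _.
  have -> : k = (k - k2 + k2)%N by rewrite subnK.
  rewrite addnK; apply: leqW; rewrite leq_add2l.
  by rewrite -(leq_add2r k2) subnK.
have h4 : s k0 `^ (1 - 2 * t) + q * (k - k0).+1%:R <= s k.+1 `^ (1 - 2 * t).
  apply: le_trans h1; apply: lerD => //.
  by rewrite (mulrC 2) -[leRHS]mulrA ler_wpM2l // ltW.
have X0 : 0 < s k0 `^ (1 - 2 * t) + q * (k - k0).+1%:R.
  by rewrite ltr_pwDl ?powR_gt0 // mulr_ge0 ?ler0n // ltW.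
rewrite -{1}[s k.+1]pK ?(ltW s1) //.
rewrite (_ : 1 / (1 - 2 * t) = - (2 * t - 1)^-1); last first.
  by rewrite -invrN opprB div1r.
rewrite !powRN lef_pV2 ?posrE ?powR_gt0 //.
by apply: ge0_ler_powR; rewrite ?nnegrE ?powR_ge0 ?(ltW X0) ?invr_ge0 ?(ltW p0).
Qed.

End RecursionRates.

(** Stands for the limit [e -> 0]: if [r < 0], the chosen [e] has [e * C <= - r / 2], a
    contradiction. Optimality along segments and the passage to cluster points both end here. *)
Lemma ge0_small_perturb (R : realType) (r C : R) : 0 <= C ->
  (forall e, 0 < e <= 1 -> - (e * C) <= r) -> 0 <= r.
Proof.
move=> C0 key; rewrite leNgt; apply/negP => r0.
have C1 : 0 < C + 1 by lra.
pose e := Num.min 1 (- r / (2 * (C + 1))).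
have e0 : 0 < e by rewrite lt_min ltr01 /= divr_gt0 ?mulr_gt0 // oppr_gt0.
have e1 : e <= 1 by rewrite ge_min lexx.
have := key e; rewrite e0 e1 => /(_ isT).
have : e <= - r / (2 * (C + 1)) by rewrite ge_min lexx orbT.
by rewrite ler_pdivlMr ?mulr_gt0 //; nra.
Qed.

(** * Column spans of lists of vectors *)

Section ColumnSpan.
Variables (R : realType) (n : nat).
Local Notation vec := 'cV[R[i]]_n.
Implicit Types (W : seq vec) (v z : vec).

Lemma convex_combE v z (l : R) :
  l%:C%C *: z + (1 - l)%:C%C *: v = v + l%:C%C *: (z - v).
Proof.
by rewrite rmorphB rmorph1 scalerBl scale1r scalerBr addrCA.
Qed.

Definition in_colspan W z := exists b : 'cV[R[i]]_(size W), z = colmat W *m b.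

(** Coefficients indexed by natural numbers have a type independent of the length of the list, so
    spans can be followed through [rcons] and [idcols] without casts. *)
Lemma in_colspanP W z : in_colspan W z <->
  exists c : nat -> R[i], z = \sum_(0 <= j < size W) c j *: nth 0 W j.
Proof.
split=> [[b ->]|[c ->]].
  exists (fun j => oapp (fun i => b i 0) 0 (insub j)); rewrite big_mkord.
  apply/matrixP => i j; rewrite (ord1 j) mxE summxE; apply: eq_bigr => k _.
  by rewrite !mxE valK /= mulrC.
exists (\col_j c j); rewrite big_mkord.
apply/matrixP => i j; rewrite (ord1 j) mxE summxE; apply: eq_bigr => k _.
by rewrite !mxE mulrC.
Qed.

Lemma in_colspan_rcons W v z : in_colspan W z -> in_colspan (rcons W v) z.
Proof.
move=> /in_colspanP[c ->]; apply/in_colspanP.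
exists (fun j => if (j < size W)%N then c j else 0).
rewrite size_rcons big_nat_recr //= ltnn scale0r addr0.
by apply: eq_big_nat => j /andP[_ jW]; rewrite jW nth_rcons jW.
Qed.

Lemma in_colspan_idcols z : in_colspan (idcols R n) z.
Proof.
apply/in_colspanP; exists (fun j => oapp (fun i => z i 0) 0 (insub j)).
rewrite size_map size_enum_ord big_mkord.
apply/matrixP => i j; rewrite (ord1 j) summxE (bigD1 i) //= big1 => [|k ki].
  by rewrite mxE valK /= (nth_map i) ?size_enum_ord // nth_ord_enum !mxE eqxx mulr1 addr0.
rewrite mxE (nth_map i) ?size_enum_ord // nth_ord_enum !mxE eq_sym.
by rewrite (negbTE ki) mulr0.
Qed.

Lemma in_colspan_line W v z (l : R) : in_colspan W v -> in_colspan W z ->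
  in_colspan W (v + l%:C%C *: (z - v)).
Proof.
move=> [b ->] [b' ->]; exists (b + l%:C%C *: (b' - b)).
by rewrite mulmxDr -scalemxAr mulmxBr.
Qed.

End ColumnSpan.

(** * The quadratic model and its first-order optimality *)

Section ProximalModel.
Variables (R : realType) (n m : nat) (A : 'M[R[i]]_(m, n)) (y : 'cV[R[i]]_m).
Local Notation vec := 'cV[R[i]]_n.
Variables (p xk : vec) (a : R) (M : 'M[R[i]]_n).

(** With [p = gradf (x k)] and [xk = x k] this is convertible to the [Fbar k] of [GKSM], and
    [prox_grad] at [x k.+1] is its residual [r]. *)
Definition prox_model (z : vec) : R :=
  hfun A y z + rip p z + (2 * a)^-1 * complex.Re (cdot (z - xk) (M *m (z - xk))).

Definition prox_grad (z : vec) : vec :=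
  gradh A y z + p + (a^-1)%:C%C *: (M *m (z - xk)).

(** A quadratic equals its second-order expansion; [M] being Hermitian merges the two cross
    terms. *)
Lemma prox_modelD (w e : vec) : 0 < a -> hermitianM M ->
  prox_model (w + e) = prox_model w + rip (prox_grad w) e
    + (2^-1 * normv (A *m e) ^+ 2 + (2 * a)^-1 * rip e (M *m e)).
Proof.
move=> a0 herm; rewrite /prox_model /prox_grad hfunD.
rewrite -[complex.Re _]/(rip (w + e - xk) (M *m (w + e - xk))).
rewrite -[complex.Re _]/(rip (w - xk) (M *m (w - xk))).
rewrite (addrAC w e); move: (w - xk) => d.
rewrite mulmxDr !ripE_lin.
have -> : rip d (M *m e) = rip (M *m d) e by rewrite rip_mulmxr herm.
by rewrite (ripC e (M *m d)); field; rewrite gt_eqF.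
Qed.

(** Along [w + l e] the model changes by [l * r + l ^ 2 * Q] with [Q >= 0]; dividing by [l] and
    letting it tend to [0] leaves [0 <= r]. *)
Lemma prox_min_optimality (w e : vec) : 0 < a -> hermitianM M ->
  0 <= rip e (M *m e) ->
  (forall l : R, 0 < l <= 1 -> prox_model w <= prox_model (w + l%:C%C *: e)) ->
  0 <= rip (prox_grad w) e.
Proof.
move=> a0 herm Me wmin.
set r := rip _ e; pose Q := 2^-1 * normv (A *m e) ^+ 2 + (2 * a)^-1 * rip e (M *m e).
have Q0 : 0 <= Q.
  by rewrite addr_ge0 ?mulr_ge0 ?exprn_ge0 ?normv_ge0 ?invr_ge0 ?mulr_ge0 // ltW.
apply: (ge0_small_perturb Q0) => l l01.
have := wmin _ l01; rewrite prox_modelD // ripZr -/r.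
rewrite -!scalemxAr normvZ !ripE_lin exprMn.
case/andP: l01 => l0 l1; rewrite (gtr0_norm l0) => h.
have : 0 <= l * (r + l * Q) by rewrite /Q; lra.
by rewrite pmulr_rge0 // -lerBlDr sub0r.
Qed.

End ProximalModel.

(** * Subgradients of indicators and of smooth functions plus indicators *)

Section Subdifferential.
Variables (R : realType) (n : nat).
Local Notation vec := 'cV[R[i]]_n.
Implicit Types (S : set vec) (F : vec -> R) (x v : vec).

Lemma frechet_subdiff_sub (chi : vec -> \bar R) x v :
  frechet_subdiff chi x v -> subdiff chi x v.
Proof.
move=> xv; exists (fun=> x), (fun=> v); split => //.
- by rewrite /cvgv subrr normv0; exact: cvg_cst.
- by case: xv.
- exact: cvg_cst.
- by rewrite /cvgv subrr normv0; exact: cvg_cst.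
Qed.

Lemma indicator_in S x : S x -> indicator S x = 0%E.
Proof. by move=> Sx; rewrite /indicator asboolT. Qed.

Lemma subdiff_indicator S x v : S x ->
  (forall z, S z -> rip v (z - x) <= 0) -> subdiff (indicator S) x v.
Proof.
move=> Sx nv; apply: frechet_subdiff_sub; split; first by rewrite indicator_in.
move=> e e0; exists 1 => // z _; rewrite indicator_in // add0e.
have [Sz|nSz] := pselect (S z); last by rewrite /indicator asboolF ?leey.
rewrite indicator_in // lee_fin subr_le0 (le_trans (nv _ Sz)) //.
by rewrite mulr_ge0 ?normv_ge0 // ltW.
Qed.

(** Checked already for regular subgradients: on [S] differentiability of [F] absorbs the error into
    [e], and off [S] the function is [+oo]. *)
Lemma subdiff_add_indicator F g S x v : is_gradient F g -> S x ->
  (forall z, S z -> rip v (z - x) <= 0) ->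
  subdiff (fun z => ((F z)%:E + indicator S z)%E) x (g x + v).
Proof.
move=> Fg Sx nv; apply: frechet_subdiff_sub; split; first by rewrite indicator_in.
move=> e e0; have [d d0 Hd] := Fg x e e0; exists d => // z zd.
rewrite indicator_in // adde0.
have [Sz|nSz] := pselect (S z); last first.
  by rewrite /indicator [in leRHS]asboolF // addey // leey.
rewrite indicator_in // adde0 -EFinD lee_fin ripDl.
have := Hd _ zd; rewrite [x + _]addrC subrK ler_norml => /andP[h _].
have := nv _ Sz; lra.
Qed.

End Subdifferential.

Lemma ltr_subr_dist (R : realType) (l a b e : R) :
  `|l - a| < e / 2 -> `|l - b| < e / 2 -> a - b < e.
Proof. by rewrite !ltr_norml => /andP[? ?] /andP[? ?]; lra. Qed.

(** * Descent, vanishing steps and cluster points of the iteration *)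

Section GKSMConvergence.
Variables (R : realType) (N m : nat) (A : 'M[R[i]]_(m, N)) (y : 'cV[R[i]]_m).
Local Notation vec := 'cV[R[i]]_N.
Variables (f : vec -> R) (gradf : vec -> vec) (L : R) (S : set vec) (K : nat).
Variables (alpha : nat -> R) (B : nat -> 'M[R[i]]_N) (etaL etaH amin amax : R).
Variables (x : nat -> vec) (V : nat -> seq vec).
Hypothesis f_grad : is_gradient f gradf.
Hypothesis L_gt0 : 0 < L.
Hypothesis gradf_lip : lipschitzv gradf L.
Hypothesis f_lbound : exists lb : R, forall z, lb <= f z.
Hypothesis S_closed : closedv S.
Hypothesis S_convex : convexv S.
Hypothesis etaL_gt0 : 0 < etaL.
Hypothesis etaLH : etaL <= etaH.
Hypothesis B_bounds : forall k, (1 <= k)%N ->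
  hermitianM (B k) /\ loewner_bounds etaL etaH (B k).
Hypothesis amin_gt0 : 0 < amin.
Hypothesis amax_lt : amax < 2 * etaL / (etaL + L).
Hypothesis alpha_bounds : forall k, (1 <= k)%N -> amin <= alpha k <= amax.
Hypothesis gksm : GKSM A y gradf S K alpha B x V.

Local Notation F z := (hfun A y z + f z).
Local Notation gradF z := (gradh A y z + gradf z).
Local Notation ups := (etaL / amax - (etaL + L) / 2).
Local Notation d k := (x k.+1 - x k).
Local Notation G k :=
  (prox_grad A y (gradf (x k)) (x k) (alpha k) (B k) (x k.+1)).

Let etaH_gt0 : 0 < etaH.
Proof. exact: lt_le_trans etaLH. Qed.

Let alpha_gt0 k : (1 <= k)%N -> 0 < alpha k.
Proof. by move=> /alpha_bounds /andP[h _]; exact: lt_le_trans h. Qed.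

Let amax_gt0 : 0 < amax.
Proof.
by have /andP[h1 h2] := alpha_bounds (leqnn 1); rewrite (lt_le_trans amin_gt0) // (le_trans h1).
Qed.

Lemma ups_gt0 : 0 < ups.
Proof.
have eL : 0 < etaL + L by rewrite addr_gt0.
rewrite subr_gt0 ltr_pdivlMr // mulrAC ltr_pdivrMr //.
by move: amax_lt; rewrite ltr_pdivlMr // (mulrC amax) (mulrC 2).
Qed.

(** A basis is kept, extended by a column, or replaced by the identity, so each iterate lies in the
    next span. Hence [x k] is an admissible competitor in step [k], as the decrease estimate
    requires. *)
Lemma gksm_feasible k : (1 <= k)%N -> S (x k) /\ in_colspan (V k) (x k).
Proof.
have [_ [S1 V1] step ext full] := gksm.
case: k => // k _; elim: k => [//|k _]; split.
  by have [b [-> Sb _]] := step k.+1 isT.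
have xV : in_colspan (V k.+1) (x k.+2).
  by have [b [-> _ _]] := step k.+1 isT; exists b.
have [kK|Kk] := leqP k.+1 K; last by rewrite full //; exact: in_colspan_idcols.
by rewrite ext //=; case: ifP => // _; exact: in_colspan_rcons.
Qed.

(** [S] is convex and the span is a subspace, so the segment from [x k.+1] to [z] is admissible and
    first-order optimality applies along it. *)
Lemma gksm_variational k z : (1 <= k)%N -> S z -> in_colspan (V k) z ->
  0 <= rip (G k) (z - x k.+1).
Proof.
move=> k1 Sz Vz; have [_ _ step _ _] := gksm.
have [b [xE Sb bmin]] := step k k1.
have [herm bnd] := B_bounds k1.
apply: prox_min_optimality; [exact: alpha_gt0|exact: herm| |].
  by apply: le_trans (proj1 (bnd _)); rewrite mulr_ge0 ?exprn_ge0 ?normv_ge0 // ltW.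
move=> l /andP[l0 l1].
have [b' b'E] : in_colspan (V k) (x k.+1 + l%:C%C *: (z - x k.+1)).
  by apply: in_colspan_line => //; exists b.
rewrite b'E xE; apply: bmin; rewrite -b'E xE.
have l01 : 0 <= l <= 1 by rewrite ltW.
have := S_convex Sz Sb l01.
by rewrite convex_combE.
Qed.

(** [V k] is the identity basis once [k - 1] exceeds [K], whence [K.+2]. *)
Lemma gksm_variational_full k z : (K.+2 <= k)%N -> S z ->
  0 <= rip (G k) (z - x k.+1).
Proof.
case: k => // k Kk Sz; apply: gksm_variational => //.
have [_ _ _ _ full] := gksm.
by rewrite full //; exact: in_colspan_idcols.
Qed.

(** The [B k]-form of the step, over [2 * alpha k], enters twice: as the proximal term at [x k.+1]
    and as the remainder of the expansion towards [x k]. Subtracting the [L / 2] of the descent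
    lemma leaves [ups] plus a margin [etaL / 2]. *)
Lemma gksm_decrease k : (1 <= k)%N ->
  ups * normv (d k) ^+ 2 <= F (x k) - F (x k.+1).
Proof.
move=> k1; have [Sx Vx] := gksm_feasible k1.
have [herm bnd] := B_bounds k1; have a0 := alpha_gt0 k1.
have /andP[_ a_max] := alpha_bounds k1.
have opt := gksm_variational k1 Sx Vx.
have := prox_modelD A y (gradf (x k)) (x k) (x k.+1) (x k - x k.+1) a0 herm.
rewrite addrCA subrr addr0 /prox_model subrr.
rewrite -![complex.Re _]/(rip _ _) mulmx0 rip0r mulr0 addr0.
have -> : rip (x k - x k.+1) (B k *m (x k - x k.+1)) = rip (d k) (B k *m d k).
  by rewrite -opprB mulmxN ripNl ripNr opprK.
have := lipschitz_gradient_le (x k) (d k) f_grad gradf_lip.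
rewrite (addrC (x k) (d k)) subrK (ripDr (gradf _)) (ripNr (gradf _)).
move: (proj1 (bnd (d k))); rewrite -[complex.Re _]/(rip _ _) => lo des E.
have nd : 0 <= normv (d k) ^+ 2 by rewrite exprn_ge0 ?normv_ge0.
have nA : 0 <= normv (A *m (x k - x k.+1)) ^+ 2 by rewrite exprn_ge0 ?normv_ge0.
have h1 : (alpha k)^-1 * (etaL * normv (d k) ^+ 2)
    <= (alpha k)^-1 * rip (d k) (B k *m d k).
  by rewrite ler_wpM2l // invr_ge0 ltW.
have h2 : amax^-1 * (etaL * normv (d k) ^+ 2) <= (alpha k)^-1 * (etaL * normv (d k) ^+ 2).
  by rewrite ler_wpM2r ?lef_pV2 ?posrE // mulr_ge0 // ltW.
have h3 : 0 <= etaL * normv (d k) ^+ 2 by rewrite mulr_ge0 // ltW.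
have h4 : (2 * alpha k)^-1 * rip (d k) (B k *m d k)
    = (alpha k)^-1 * rip (d k) (B k *m d k) / 2 by rewrite invfM mulrC mulrA mulrC mulrA.
rewrite h4 in E.
have -> : ups * normv (d k) ^+ 2 =
  amax^-1 * (etaL * normv (d k) ^+ 2) - etaL * normv (d k) ^+ 2 / 2
  - L / 2 * normv (d k) ^+ 2 by field; rewrite gt_eqF.
move: (rip (G k) _) opt E => g opt E.
move: (amax^-1 * _) h2 => w h2; move: ((alpha k)^-1 * (etaL * _)) h1 h2 => u h1 h2.
move: ((alpha k)^-1 * _) h1 E => q h1 E; move: (etaL * _) h3 {lo} => e h3.
move: (L / 2 * _) des => z; move: (normv (A *m _) ^+ 2) nA E => nAd nA.
move: (rip _ (x k)) (rip _ (x k.+1)) (hfun A y (x k)) (hfun A y (x k.+1)).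
move: (f (x k)) (f (x k.+1)) => r1 r2 r3 r4 r5 r6 E des.
lra.
Qed.

Lemma gksm_nonincreasing k : (1 <= k)%N -> F (x k.+1) <= F (x k).
Proof.
move=> k1; rewrite -subr_ge0; apply: le_trans (gksm_decrease k1).
by rewrite mulr_ge0 ?exprn_ge0 ?normv_ge0 // ltW // ups_gt0.
Qed.

Lemma gksm_antitone k j : (1 <= k)%N -> (k <= j)%N -> F (x j) <= F (x k).
Proof.
move=> k1 /subnKC <-; elim: (j - k)%N => [|i IH]; first by rewrite addn0.
by rewrite addnS (le_trans _ IH) // gksm_nonincreasing // (leq_trans k1) ?leq_addr.
Qed.

Lemma gksm_step_cvg0 : (fun k => normv (d k)) @ \oo --> (0 : R).
Proof.
have u0 := ups_gt0.
(* The index is shifted because monotonicity starts at index [1]. *)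
have cvF : cvgn (fun k => F (x k.+1)).
  apply: nonincreasing_is_cvgn.
    by move=> i j ij; exact: gksm_antitone.
  have [lb Hlb] := f_lbound; exists lb => _ [k _ <-].
  by rewrite -[lb]add0r lerD ?hfun_ge0.
apply/cvgr0Pnorm_lt => e e0.
have e1 : 0 < ups * e ^+ 2 / 2 by rewrite divr_gt0 // mulr_gt0 // exprn_gt0.
have /cvgrPdist_lt /(_ _ e1) [n _ Hn] := cvF.
exists n.+1 => // -[//|k] /= nk; rewrite ger0_norm ?normv_ge0 //.
have : ups * normv (d k.+1) ^+ 2 < ups * e ^+ 2.
  apply: le_lt_trans (gksm_decrease (ltn0Sn k)) _.
  exact: ltr_subr_dist (Hn k nk) (Hn k.+1 (leqW nk)).
by rewrite ltr_pM2l // ltr_sqr ?nnegrE ?normv_ge0 // ltW.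
Qed.

(** The vector is [gradF (x k.+1) - G k], the gap between true and model gradients at the new
    iterate. *)
Lemma gksm_grad_error_le k : (1 <= k)%N ->
  normv (gradf (x k.+1) - gradf (x k) - ((alpha k)^-1)%:C%C *: (B k *m d k))
    <= (L + (alpha k)^-1 * etaH) * normv (d k).
Proof.
move=> k1; have [herm bnd] := B_bounds k1; have a0 := alpha_gt0 k1.
apply: le_trans (ler_normvD _ _) _; rewrite mulrDl lerD //.
rewrite normvN normvZ ger0_norm ?invr_ge0 ?(ltW a0) // -mulrA.
by rewrite ler_wpM2l ?invr_ge0 ?(ltW a0) // (loewner_normv_le _ etaL_gt0).
Qed.

Lemma gksm_cluster_in xh :
  (forall (e : R) (n : nat), 0 < e -> exists2 k, (n <= k)%N & normv (x k - xh) < e) ->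
  S xh.
Proof.
move=> cl; apply: S_closed => e e0; have [k k1 ke] := cl e 1%N e0.
by exists (x k); split=> //; have [] := gksm_feasible k1.
Qed.

(** At indices where [x k] is within [e] of [xh] and the step is below [e], the inequality at
    [x k.+1] transfers to [xh] with an error linear in [e]. *)
Lemma gksm_cluster_variational xh z :
  (forall (e : R) (n : nat), 0 < e -> exists2 k, (n <= k)%N & normv (x k - xh) < e) ->
  S z -> 0 <= rip (gradF xh) (z - xh).
Proof.
move=> cl Sz; have [b b0 hb] := gradh_lipschitz A y.
(* Per unit of [e], [2 * b] pays for [gradh] at distance [2 * e], [L] for [gradf] at distance [e],
   and the last term for the proximal part. [C] is the resulting error in [rip_perturb_ge], where
   [e <= 1] bounds [2 * e] by [2]. *)
pose c1 := 2 * b + L + amin^-1 * etaH.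
pose C := 2 * normv (gradF xh) + c1 * (normv (z - xh) + 2).
have c10 : 0 < c1.
  by rewrite addr_gt0 ?(mulr_gt0 _ etaH_gt0) ?invr_gt0 // ltr_wpDl // mulr_ge0.
have C0 : 0 <= C.
  have z2 : 0 <= normv (z - xh) + 2 by rewrite addr_ge0 ?normv_ge0.
  by apply: addr_ge0; apply: mulr_ge0; rewrite ?normv_ge0 // ltW.
apply: (ge0_small_perturb C0) => e /andP[e0 e1].
have /cvgr0Pnorm_lt /(_ _ e0) [n1 _ Hn1] := gksm_step_cvg0.
(* Indices beyond [n1] have small steps, and from [K.+2] on the subspace is full. *)
have [k kn xk] := cl e (n1 + K.+2)%N e0.
have k1 : (1 <= k)%N by apply: leq_trans kn; rewrite addnS.
have := Hn1 k (leq_trans (leq_addr _ _) kn).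
rewrite /= ger0_norm ?normv_ge0 // => dk.
have xk1 : normv (x k.+1 - xh) <= 2 * e.
  rewrite -(subrK (x k) (x k.+1)) -addrA; apply: le_trans (ler_normvD _ _) _.
  by rewrite mulr_natl mulr2n; apply: lerD; apply: ltW.
have opt := gksm_variational_full (leq_trans (leq_addl _ _) kn) Sz.
have [herm bnd] := B_bounds k1; have a0 := alpha_gt0 k1.
have /andP[a_min _] := alpha_bounds k1.
have GF : normv (G k - gradF xh) <= c1 * e.
  rewrite /prox_grad (_ : _ - _ = (gradh A y (x k.+1) - gradh A y xh)
    + (gradf (x k) - gradf xh) + ((alpha k)^-1)%:C%C *: (B k *m d k)); last first.
    by rewrite opprD addrAC addrACA.
  apply: le_trans (ler_normvD _ _) _; rewrite /c1 mulrDl lerD //.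
    apply: le_trans (ler_normvD _ _) _; rewrite mulrDl lerD //.
      by apply: le_trans (hb _ _) _; rewrite (mulrC 2) -mulrA ler_wpM2l.
    by apply: le_trans (gradf_lip _ _) _; apply: ler_wpM2l; apply: ltW.
  rewrite normvZ ger0_norm ?invr_ge0 ?(ltW a0) // -mulrA.
  rewrite ler_pM ?invr_ge0 ?(ltW a0) ?normv_ge0 //; first by rewrite lef_pV2 ?posrE.
  apply: le_trans (loewner_normv_le _ etaL_gt0 etaLH herm bnd) _.
  by rewrite ler_wpM2l ?ltW.
have zx : normv (z - x k.+1) <= normv (z - xh) + 2.
  rewrite -(subrK xh z) -addrA; apply: le_trans (ler_normvD _ _) _.
  rewrite subrK lerD2l normvB; apply: le_trans xk1 _.
  by rewrite -[leRHS]mulr1 ler_wpM2l.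
apply: le_trans (rip_perturb_ge opt GF xk1 zx).
have CE (r1 r2 r3 : R) : e * (2 * r1 + r3 * (r2 + 2)) = r1 * (2 * e) + r3 * e * (r2 + 2).
  by ring.
by rewrite lerN2 /C CE.
Qed.

(** * From the KL inequality to the scalar recursion *)

Section Rates.
Variables (xs : vec) (c t eta : R) (U : set vec).
Hypothesis x_cvg : cvgv x xs.
Hypothesis c_gt0 : 0 < c.
Hypothesis t01 : 0 <= t < 1.
Hypothesis FC_KL : KL_at (fun z => ((F z)%:E + indicator S z)%E) xs eta U
  (fun s => c * s `^ (1 - t)).

Local Notation gam := (sup [set (c * (L * alpha k + etaH)) ^+ 2
  / (ups * (1 - t) ^+ 2 * alpha k ^+ 2) | k in [set k : nat | (1 <= k)%N]]).

Let t1 : 0 < 1 - t.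
Proof. by case/andP: t01 => _; rewrite subr_gt0. Qed.

Lemma gksm_limit_in : S xs.
Proof.
apply: gksm_cluster_in => e n e0; have /cvgr0Pnorm_lt /(_ _ e0) [k _ Hk] := x_cvg.
exists (n + k)%N; first exact: leq_addr.
by have := Hk (n + k)%N (leq_addl _ _); rewrite /= ger0_norm ?normv_ge0.
Qed.

Lemma gksm_value_cvg : (fun k => F (x k)) @ \oo --> F xs.
Proof.
exact: (is_gradient_cvg (is_gradientD (is_gradient_hfun A y) f_grad) x_cvg).
Qed.

Lemma gksm_limit_value_le k : (1 <= k)%N -> F xs <= F (x k).
Proof.
move=> k1; rewrite leNgt -subr_gt0; apply/negP => e0.
have /cvgrPdist_lt /(_ _ e0) [n _ Hn] := gksm_value_cvg.
have := Hn (n + k)%N (leq_addr _ _); rewrite /= ltr_norml => /andP[_].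
by rewrite ltrD2l ltrN2 ltNge gksm_antitone // leq_addl.
Qed.

(** The stepsize bounds cap the set, with [amax] in the numerator and [amin] in the denominator, so
    the supremum does dominate each element. *)
Lemma gksm_rate_le k : (1 <= k)%N ->
  0 < (c * (L * alpha k + etaH)) ^+ 2 / (ups * (1 - t) ^+ 2 * alpha k ^+ 2) <= gam.
Proof.
have pos j : (1 <= j)%N -> 0 < L * alpha j + etaH.
  by move=> /alpha_gt0 h; rewrite addr_gt0 // mulr_gt0.
have den a : 0 < a -> 0 < ups * (1 - t) ^+ 2 * a ^+ 2.
  by move=> h; rewrite !mulr_gt0 ?exprn_gt0 ?ups_gt0.
move=> k1; apply/andP; split.
  apply: divr_gt0; last exact: den (alpha_gt0 k1).
  by rewrite exprn_gt0 // mulr_gt0 // pos.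
apply: ub_le_sup; last by exists k.
exists ((c * (L * amax + etaH)) ^+ 2 / (ups * (1 - t) ^+ 2 * amin ^+ 2)).
move=> _ [j /= j1 <-]; have /andP[h1 h2] := alpha_bounds j1; have a0 := alpha_gt0 j1.
have p1 := pos j j1.
have up := ups_gt0.
apply: ler_pM.
- by rewrite exprn_ge0 // mulr_ge0 // ltW.
- by rewrite invr_ge0 ltW // den.
- rewrite ler_sqr ?nnegrE ?mulr_ge0 ?(ltW p1) ?(ltW c_gt0) //; last first.
    by rewrite addr_ge0 ?mulr_ge0 // ltW.
  by rewrite ler_wpM2l ?(ltW c_gt0) // lerD2r ler_wpM2l ?(ltW L_gt0).
- rewrite lef_pV2 ?posrE ?den // ler_wpM2l ?mulr_ge0 ?exprn_ge0 ?(ltW up) ?(ltW t1) //.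
  by rewrite ler_sqr ?nnegrE ?(ltW a0) ?(ltW amin_gt0).
Qed.

Lemma gam_gt0 : 0 < gam.
Proof. by have /andP[h1 h2] := gksm_rate_le (leqnn 1); exact: lt_le_trans h2. Qed.

(** KL bounds s^t by c (1 - t) times a subgradient norm, hence by a multiple of the step length;
    squaring and the decrease estimate then eliminate the step. *)
Lemma gksm_KL_recursion k : (K.+2 <= k)%N -> U (x k.+1) ->
  F (x k.+1) - F xs < eta -> 0 < F (x k.+1) - F xs ->
  (F (x k.+1) - F xs) `^ (2 * t) <= gam * (F (x k) - F (x k.+1)).
Proof.
move=> Kk Ux se s0; set s := F (x k.+1) - F xs in se s0 *.
have k1 : (1 <= k)%N by apply: leq_trans Kk.
have [Sx _] := gksm_feasible (leqW k1 : (1 <= k.+1)%N).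
have a0 := alpha_gt0 k1.
(* The variational inequality against all of [S] makes [- G k] normal to [S] at [x k.+1]. *)
pose v := gradF (x k.+1) + - G k.
have vsub : subdiff (fun z => ((F z)%:E + indicator S z)%E) (x k.+1) v.
  apply: (subdiff_add_indicator (is_gradientD (is_gradient_hfun A y) f_grad)) => // z Sz.
  by rewrite ripNl oppr_le0 gksm_variational_full.
have vE : v = gradf (x k.+1) - gradf (x k) - ((alpha k)^-1)%:C%C *: (B k *m d k).
  rewrite /v /prox_grad !opprD !addrA (addrAC _ (gradf _) (- gradh _ _ _)).
  by rewrite subrr add0r.
have vle := gksm_grad_error_le k1; rewrite -vE in vle.
have [_ _ KL] := FC_KL.
have := KL _ Ux; rewrite !indicator_in //; last exact: gksm_limit_in.
rewrite !adde0 -EFinB /= -/s (gtr0_norm s0) !lte_fin s0 se => /(_ isT) KLx.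
have phiE : derive1 (fun r : R => c * r `^ (1 - t)) s = c * ((1 - t) * s `^ (- t)).
  have h := is_derive1_powR (1 - t) s0.
  have h2 : is_derive s 1 (c \*: (@powR R ^~ (1 - t))) (c *: ((1 - t) * s `^ (1 - t - 1))).
    exact: is_deriveZ.
  rewrite derive1E; have -> := @derive_val _ _ _ _ _ _ _ h2.
  by rewrite (_ : 1 - t - 1 = - t) //; ring.
have st0 : 0 < s `^ t by exact: powR_gt0.
rewrite phiE in KLx.
have q0 : 0 < c * ((1 - t) * s `^ (- t)) by rewrite !mulr_gt0 // powR_gt0.
have : (1%:E <= (c * ((1 - t) * s `^ (- t)))%:E * (normv v)%:E)%E.
  apply: le_trans KLx _; apply: lee_wpmul2l; first by rewrite lee_fin ltW.
  by apply: ereal_inf_lbound; exists v.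
rewrite -EFinM lee_fin powRN => one.
have h1 : s `^ t <= c * (1 - t) * normv v.
  have : s `^ t * 1 <= s `^ t * (c * ((1 - t) * (s `^ t)^-1) * normv v).
    by rewrite ler_wpM2l // ltW.
  rewrite mulr1 (_ : s `^ t * _ = c * (1 - t) * normv v) //.
  by field; rewrite gt_eqF.
have h2 : s `^ t <= c * (1 - t) * ((L + (alpha k)^-1 * etaH) * normv (d k)).
  apply: le_trans h1 _; apply: ler_wpM2l vle.
  by apply: mulr_ge0; apply: ltW.
have st2 : s `^ (2 * t) = (s `^ t) ^+ 2.
  by rewrite mulrC powRrM powR_mulrn // ltW.
have dec := gksm_decrease k1; have up := ups_gt0.
have /andP[_ gk] := gksm_rate_le k1.
rewrite st2; set e := F (x k) - F _ in dec *.
have e0 : 0 <= e by apply: le_trans dec; rewrite mulr_ge0 ?exprn_ge0 ?normv_ge0 // ltW.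
apply: le_trans (ler_wpM2r e0 gk).
have h3 : (s `^ t) ^+ 2 <= (c * (1 - t) * ((L + (alpha k)^-1 * etaH) * normv (d k))) ^+ 2.
  by rewrite ler_sqr ?nnegrE ?powR_ge0 // (le_trans (powR_ge0 _ _) h2).
apply: le_trans h3 _.
pose w := (c * (L * alpha k + etaH)) ^+ 2 / (ups * alpha k ^+ 2).
have w0 : 0 <= w.
  by rewrite divr_ge0 ?sqr_ge0 // mulr_ge0 ?sqr_ge0 // ltW.
have -> : (c * (1 - t) * ((L + (alpha k)^-1 * etaH) * normv (d k))) ^+ 2
   = (1 - t) ^+ 2 * (w * (ups * normv (d k) ^+ 2)).
  by rewrite /w; move: (ups) up => u u0; field; rewrite !gt_eqF.
have -> : (c * (L * alpha k + etaH)) ^+ 2 / (ups * (1 - t) ^+ 2 * alpha k ^+ 2) * e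
   = ((1 - t) ^+ 2)^-1 * (w * e).
  by rewrite /w; move: (ups) up => u u0; field; rewrite !gt_eqF.
(* The bound obtained carries the factor (1 - t)^2 whereas [gam] carries its inverse; since 0 < 1 -
   t <= 1, [gam] dominates. *)
have t2 : (1 - t) ^+ 2 <= 1.
  by rewrite exprn_ile1 ?(ltW t1) //; case/andP: t01 => h _; rewrite gerBl.
have t2i : 1 <= ((1 - t) ^+ 2)^-1 by rewrite invf_ge1 ?exprn_gt0.
have h5 : w * (ups * normv (d k) ^+ 2) <= w * e by rewrite ler_wpM2l.
apply: (@le_trans _ _ (1 * (w * e))).
  by rewrite ler_pM ?sqr_ge0 // mulr_ge0 // mulr_ge0 ?exprn_ge0 ?normv_ge0 // ltW.
by rewrite ler_wpM2r // mulr_ge0.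
Qed.

End Rates.

End GKSMConvergence.

(** * Criticality of cluster points and the three convergence rates *)

Theorem theorem2 (R : realType) (N m : nat)
  (A : 'M[R[i]]_(m, N)) (y : 'cV[R[i]]_m)
  (f : 'cV[R[i]]_N -> R) (gradf : 'cV[R[i]]_N -> 'cV[R[i]]_N) (L : R)
  (S : set 'cV[R[i]]_N) (K : nat) (alpha : nat -> R) (B : nat -> 'M[R[i]]_N)
  (etaL etaH amin amax : R)
  (x : nat -> 'cV[R[i]]_N) (V : nat -> seq 'cV[R[i]]_N) :
  adj A *m y != 0 ->
  is_gradient f gradf ->
  0 < L -> lipschitzv gradf L ->
  (exists lb : R, forall z, lb <= f z) ->
  closedv S -> convexv S -> (exists z, S z) ->
  (1 <= K)%N ->
  0 < etaL -> etaL <= etaH ->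
  (forall k, (1 <= k)%N -> hermitianM (B k) /\ loewner_bounds etaL etaH (B k)) ->
  0 < amin -> amax < 2 * etaL / (etaL + L) ->
  (forall k, (1 <= k)%N -> amin <= alpha k <= amax) ->
  GKSM A y gradf S K alpha B x V ->
  let F := fun z => hfun A y z + f z in
  let gradF := fun z => gradh A y z + gradf z in
  let FC := fun z => ((F z)%:E + indicator S z)%E in
  let ups := etaL / amax - (etaL + L) / 2 in
  (* (i) *)
  ((fun k => normv (x k.+1 - x k)) @ \oo --> (0 : R) /\
   forall xh, (forall (e : R) (n : nat), 0 < e ->
                 exists2 k, (n <= k)%N & normv (x k - xh) < e) ->
     exists2 v, subdiff (indicator S) xh v & gradF xh + v = 0)
  /\
  (* (ii) *)
  (forall (xs : 'cV[R[i]]_N) (c t eta Lam : R) (U : set 'cV[R[i]]_N),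
     cvgv x xs ->
     0 < c -> 0 <= t < 1 -> 0 < eta -> 0 < Lam ->
     (forall z, normv (z - xs) <= Lam -> U z) ->
     KL_at FC xs eta U (fun s => c * s `^ (1 - t)) ->
     let Fs := F xs in
     let gam := sup [set (c * (L * alpha k + etaH)) ^+ 2
                          / (ups * (1 - t) ^+ 2 * alpha k ^+ 2)
                    | k in [set k : nat | (1 <= k)%N]] in
     exists2 K' : nat, (K.+1 < K')%N &
       let FK := F (x K') - Fs in
       [/\ forall k, (K' <= k)%N ->
             normv (x k - xs) <= Lam /\ (`| FC (x k) - Fs%:E | < eta%:E)%E,
           t = 0 -> forall k, (K' <= k)%N ->
             F (x k.+1) - Fs <= Num.max (FK - gam^-1 * (k - K').+1%:R) 0,
           0 < t <= 2^-1 -> forall k, (K' <= k)%N ->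
             F (x k.+1) - Fs <=
               (1 - FK `^ (2 * t - 1) / (FK `^ (2 * t - 1) + gam)) ^+ (k - K').+1
               * FK &
           2^-1 < t < 1 -> forall sigma : R, 0 < sigma < 1 ->
             let q := (t - 2^-1) * (1 - sigma) `^ (2 * t) / gam in
             exists k0 : nat, forall k, (k0 <= k)%N -> (K' <= k)%N ->
               F (x k.+1) - Fs <=
                 (FK `^ (1 - 2 * t) + q * (k - K').+1%:R) `^ (1 / (1 - 2 * t))]).
Proof.
move=> _ f_grad L0 lip lb Scl Scv _ _ eL0 eLH Bb am0 amx ab gk F gradF FC ups.
split.
  split; first exact: (gksm_step_cvg0 f_grad L0 lip lb Scv eL0 Bb am0 amx ab gk).
  (* The variational inequality at [xh] says that [- gradF xh] is normal to [S] there. *)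
  move=> xh cl; exists (- gradF xh); last exact: subrr.
  apply: subdiff_indicator; first exact: (gksm_cluster_in Scl gk cl).
  move=> z Sz; rewrite ripNl oppr_le0.
  exact: (gksm_cluster_variational f_grad L0 lip lb Scv eL0 eLH Bb am0 amx ab gk cl Sz).
move=> xs c t eta Lam U xcv c0 t01 eta0 Lam0 ballU KL Fs gam.
have Fcv : (fun k => F (x k)) @ \oo --> Fs by exact: (gksm_value_cvg f_grad xcv).
have Sxs : S xs by exact: (gksm_limit_in Scl gk xcv).
pose s k := F (x k) - Fs.
have s_ge0 k : (1 <= k)%N -> 0 <= s k.
  move=> k1; rewrite subr_ge0.
  exact: (gksm_limit_value_le f_grad L0 lip Scv eL0 Bb am0 amx ab gk xcv k1).
have s_cvg : s @ \oo --> (0 : R).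
  rewrite -(subrr Fs); apply: cvgB => //; exact: cvg_cst.
have /cvgr0Pnorm_lt /(_ _ Lam0) [n1 _ Hn1] := xcv.
have /cvgr0Pnorm_lt /(_ _ eta0) [n2 _ Hn2] := s_cvg.
have near_ball k : (n1 <= k)%N -> normv (x k - xs) <= Lam.
  by move=> /Hn1 /=; rewrite ger0_norm ?normv_ge0 // => /ltW.
(* [K.+2] secures the full subspace, [n1] the ball of radius [Lam], and [n2] gaps below [eta]. *)
exists (K.+2 + (n1 + n2))%N; first by rewrite leq_addr.
set K' := (_ + _)%N => FK.
have K'1 k : (K' <= k)%N -> (1 <= k)%N by apply: leq_trans.
have K'K k : (K' <= k)%N -> (K.+2 <= k)%N by apply: leq_trans; exact: leq_addr.
have K'n1 k : (K' <= k)%N -> (n1 <= k)%N.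
  by apply: leq_trans; rewrite /K' addnCA leq_addr.
have K'n2 k : (K' <= k)%N -> (n2 <= k)%N.
  by apply: leq_trans; rewrite /K' addnA leq_addl.
have gam0 : 0 < gam by exact: (gam_gt0 L0 eL0 eLH am0 amx ab c0 t01).
have s_dec k : (K' <= k)%N -> s k.+1 <= s k.
  move=> /K'1 k1; rewrite lerD2r.
  exact: (gksm_nonincreasing f_grad L0 lip Scv eL0 Bb am0 amx ab gk k1).
have s_rec k : (K' <= k)%N -> 0 < s k.+1 ->
    s k.+1 `^ (2 * t) <= gam * (s k - s k.+1).
  move=> kk s1; have kk1 := leqW kk : (K' <= k.+1)%N.
  rewrite /s opprB addrA subrK.
  apply: (gksm_KL_recursion f_grad L0 lip Scl Scv eL0 eLH Bb am0 amx ab gk xcv c0 t01 KL) => //.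
  - exact: K'K.
  - by apply/ballU/near_ball/K'n1.
  - by have := Hn2 _ (K'n2 _ kk1); rewrite /= gtr0_norm.
split.
- move=> k kk; split; first exact/near_ball/K'n1.
  have [Sx _] := gksm_feasible gk (K'1 _ kk).
  rewrite /FC indicator_in // adde0 -EFinB /= lte_fin.
  exact: Hn2 (K'n2 _ kk).
- exact: (rate_finite gam0 s_rec).
- exact: (rate_linear gam0 (fun k kk => s_ge0 k (K'1 k kk)) s_dec s_rec).
- by move=> /andP[t2 _]; exact: (rate_sublinear gam0 s_dec s_rec s_cvg t2).
Qed.
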